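(* Let $w_1,w_2,w_3$ be positive integers, $n\ge0$ an integer, and $y_1\in\mathbb{Z}_p$. Then \begin{align*} &w_1^{n-1}\sum_{k=0}^n\binom{n}{k}S_{n-k,q^{w_1w_2}}(w_3-1)\,w_2^{n-k}w_3^{k-1}\sum_{i=0}^{w_1-1}q^{w_2w_3i}B_{k,q^{w_1w_3}}\Big(w_2y_1+\frac{w_2}{w_1}i\Big)\\ &=w_1^{n-1}\sum_{k=0}^n\binom{n}{k}S_{n-k,q^{w_1w_3}}(w_2-1)\,w_3^{n-k}w_2^{k-1}\sum_{i=0}^{w_1-1}q^{w_2w_3i}B_{k,q^{w_1w_2}}\Big(w_3y_1+\frac{w_3}{w_1}i\Big)\\ &=w_2^{n-1}\sum_{k=0}^n\binom{n}{k}S_{n-k,q^{w_1w_2}}(w_3-1)\,w_1^{n-k}w_3^{k-1}\sum_{i=0}^{w_2-1}q^{w_1w_3i}B_{k,q^{w_2w_3}}\Big(w_1y_1+\frac{w_1}{w_2}i\Big)\\ &=w_2^{n-1}\sum_{k=0}^n\binom{n}{k}S_{n-k,q^{w_2w_3}}(w_1-1)\,w_3^{n-k}w_1^{k-1}\sum_{i=0}^{w_2-1}q^{w_1w_3i}B_{k,q^{w_1w_2}}\Big(w_3y_1+\frac{w_3}{w_2}i\Big)\\ &=w_3^{n-1}\sum_{k=0}^n\binom{n}{k}S_{n-k,q^{w_1w_3}}(w_2-1)\,w_1^{n-k}w_2^{k-1}\sum_{i=0}^{w_3-1}q^{w_1w_2i}B_{k,q^{w_2w_3}}\Big(w_1y_1+\frac{w_1}{w_3}i\Big)\\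 &=w_3^{n-1}\sum_{k=0}^n\binom{n}{k}S_{n-k,q^{w_2w_3}}(w_1-1)\,w_2^{n-k}w_1^{k-1}\sum_{i=0}^{w_3-1}q^{w_1w_2i}B_{k,q^{w_1w_3}}\Big(w_2y_1+\frac{w_2}{w_3}i\Big). \end{align*}
   Context: Let $p$ be a prime, $\mathbb{C}_p$ the completion of an algebraic closure of $\mathbb{Q}_p$, and $|\cdot|_p$ the absolute value on $\mathbb{C}_p$ with $|p|_p=1/p$. Fix $q\in\mathbb{C}_p$ with $q\neq 1$ and $|q-1|_p<p^{-1/(p-1)}$; for every positive integer $w$, $Q=q^w$ also satisfies these conditions. For such $Q$, the $Q$-Bernoulli numbers are defined by $\frac{\log Q+t}{Qe^t-1}=\sum_{n\ge0}B_{n,Q}\frac{t^n}{n!}$ ($\log$ the $p$-adic logarithm), and the $Q$-Bernoulli polynomials by $\frac{\log Q+t}{Qe^t-1}e^{xt}=\sum_{n\ge0}B_{n,Q}(x)\frac{t^n}{n!}$, i.e. $B_{n,Q}(x)=\sum_{j=0}^n\binom{n}{j}B_{j,Q}x^{n-j}$ (a polynomial, evaluated at elements of $\mathbb{C}_p$). For integers $k\ge0$, $N\ge0$, $S_{k,Q}(N)=\sum_{i=0}^N i^kQ^i$, with $0^0=1$. *)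

(* Defs.v *)
From HB Require Import structures.
From mathcomp Require Import all_boot all_order all_algebra.
From mathcomp Require Import all_classical all_reals all_analysis.

Set Implicit Arguments.
Unset Strict Implicit.
Unset Printing Implicit Defensive.

Import Order.TTheory GRing.Theory Num.Theory.
Import numFieldNormedType.Exports.

Local Open Scope classical_set_scope.
Local Open Scope ring_scope.

Section ValuedFields.
Variable R : realType.

Record nonarch_absval (K : fieldType) (v : K -> R) : Prop := NonarchAbsval {
  absval_ge0 : forall x, 0 <= v x;
  absval_eq0 : forall x, v x = 0 <-> x = 0;
  absvalM : forall x y, v (x * y) = v x * v y;
  absvalD : forall x y, v (x + y) <= Num.max (v x) (v y) }.

Definition vcvg (K : fieldType) (v : K -> R) (u : nat -> K) (l : K) : Prop :=
  (fun n => v (u n - l)) @ \oo --> (0 : R).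

Definition vcauchy (K : fieldType) (v : K -> R) (u : nat -> K) : Prop :=
  forall e : R, 0 < e -> exists N : nat, forall m n : nat,
    (N <= m)%N -> (N <= n)%N -> v (u m - u n) < e.

(* The limit of u, or 0 when u diverges. *)
Definition vlim (K : fieldType) (v : K -> R) (u : nat -> K) : K :=
  xget 0 [set l | vcvg v u l].

Definition vcomplete (K : fieldType) (v : K -> R) : Prop :=
  forall u : nat -> K, vcauchy v u -> exists l : K, vcvg v u l.

Record is_completion (F K : fieldType) (vF : F -> R) (vK : K -> R)
    (i : {rmorphism F -> K}) : Prop := IsCompletion {
  completion_absval : nonarch_absval vK;
  completion_isometry : forall x, vK (i x) = vF x;
  completion_dense : forall (y : K) (e : R), 0 < e ->
    exists x : F, vK (y - i x) < e;
  completion_complete : vcomplete vK }.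

Record is_algebraic_closure (F L : fieldType) (i : {rmorphism F -> L}) : Prop :=
  IsAlgebraicClosure {
  algebraic_closure_closed : GRing.closed_field_axiom L;
  algebraic_closure_algebraic : forall x : L, algebraicOver i x }.

Definition padic_norm (p : nat) (x : rat) : R :=
  if x == 0 then 0
  else p%:R ^ ((logn p `|denq x|)%:Z - (logn p `|numq x|)%:Z).

(* C_p with the tower Q -> Q_p -> Qbar_p -> C_p it is built from; these data
   are unique up to isometric isomorphism.  The R-valued absolute values are
   normalized by |p| = 1/p through padic_norm. *)
Record padic_complex (p : nat) : Type := PadicComplex {
  Qp : fieldType;
  Qp_abs : Qp -> R;
  Qp_of_rat : {rmorphism rat -> Qp};
  Qp_completion : is_completion (padic_norm p) Qp_abs Qp_of_rat;
  Qpbar : fieldType;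
  Qpbar_abs : Qpbar -> R;
  Qpbar_of_Qp : {rmorphism Qp -> Qpbar};
  Qpbar_closure : is_algebraic_closure Qpbar_of_Qp;
  Qpbar_absval : nonarch_absval Qpbar_abs;
  Qpbar_extends : forall x : Qp, Qpbar_abs (Qpbar_of_Qp x) = Qp_abs x;
  Cp :> fieldType;
  Cp_abs : Cp -> R;
  Cp_of_Qpbar : {rmorphism Qpbar -> Cp};
  Cp_completion : is_completion Qpbar_abs Cp_abs Cp_of_Qpbar } as C.

Definition Cp_of_Qp (p : nat) (C : padic_complex p) (x : Qp C) : C :=
  Cp_of_Qpbar C (Qpbar_of_Qp C x).

Definition padic_int (p : nat) (C : padic_complex p) : set (Qp C) :=
  [set x | Qp_abs x <= 1].

(* log x = \sum_(n >= 1) (-1)^(n-1) (x - 1)^n / n, used where |x - 1| < 1. *)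
Definition padic_log (p : nat) (C : padic_complex p) (x : C) : C :=
  vlim (@Cp_abs p C)
    (fun N => \sum_(1 <= n < N) (-1) ^+ n.-1 * (x - 1) ^+ n / n%:R).

End ValuedFields.

(* Formal power series in t, given by their coefficients. *)
Section FormalPowerSeries.
Variable K : fieldType.
Implicit Types a b : nat -> K.

Definition fps_mul a b : nat -> K := fun n => \sum_(i < n.+1) a i * b (n - i)%N.

Fixpoint fps_inv_seq a (n : nat) : seq K :=
  if n is m.+1 then
    let s := fps_inv_seq a m in
    rcons s ((a 0%N)^-1 * ((m == 0%N)%:R - \sum_(i < m) s`_i * a (m - i)%N))
  else [::].

(* The multiplicative inverse of a when a 0 != 0, see fps_mulVf. *)
Definition fps_inv a : nat -> K := fun n => (fps_inv_seq a n.+1)`_n.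

Lemma size_fps_inv_seq a n : size (fps_inv_seq a n) = n.
Proof. by elim: n => //= n IH; rewrite size_rcons IH. Qed.

Lemma nth_fps_inv_seq a n i : (i < n)%N -> (fps_inv_seq a n)`_i = fps_inv a i.
Proof.
elim: n => // n IH; rewrite ltnS leq_eqVlt => /predU1P[->//|lt_in].
by rewrite /= nth_rcons size_fps_inv_seq lt_in IH.
Qed.

Lemma fps_mulVf a : a 0%N != 0 -> fps_mul (fps_inv a) a = fun n => (n == 0%N)%:R.
Proof.
move=> a0; apply/funext => n; rewrite /fps_mul big_ord_recr /= subnn.
have -> : fps_inv a n =
    (a 0%N)^-1 * ((n == 0%N)%:R - \sum_(i < n) fps_inv a i * a (n - i)%N).
  rewrite /fps_inv /= nth_rcons size_fps_inv_seq ltnn eqxx.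
  by under eq_bigr do rewrite nth_fps_inv_seq //.
by rewrite mulrAC mulVf // mul1r addrC subrK.
Qed.

(* e^(c t) *)
Definition fps_exp (c : K) : nat -> K := fun n => c ^+ n / n`!%:R.

End FormalPowerSeries.

Section QBernoulli.
Variables (R : realType) (p : nat) (C : padic_complex R p).

(* (log Q + t) / (Q e^t - 1) *)
Definition qbernoulli_gf (Q : C) : nat -> C :=
  fps_mul (fun n => if n is m.+1 then (m == 0%N)%:R else padic_log Q)
          (fps_inv (fun n => Q * fps_exp 1 n - (n == 0%N)%:R)).

Definition qbernoulli_num (n : nat) (Q : C) : C := n`!%:R * qbernoulli_gf Q n.

Definition qbernoulli_poly (n : nat) (Q : C) : {poly C} :=
  \sum_(j < n.+1) ('C(n, j)%:R * qbernoulli_num j Q) *: 'X^(n - j).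

Definition qpower_sum (k : nat) (Q : C) (N : nat) : C :=
  \sum_(i < N.+1) i%:R ^+ k * Q ^+ i.

Lemma Cp_natr_neq0 (n : nat) : (0 < n)%N -> n%:R != 0 :> C.
Proof.
move=> n0.
rewrite -(rmorph_nat (Cp_of_Qpbar C)) fmorph_eq0.
rewrite -(rmorph_nat (Qpbar_of_Qp C)) fmorph_eq0.
rewrite -(rmorph_nat (Qp_of_rat C)) fmorph_eq0.
by rewrite pnatr_eq0 -lt0n.
Qed.

(* The exponential generating series of B_{n,Q}(x) is
   (log Q + t) / (Q e^t - 1) * e^(x t). *)
Lemma qbernoulli_polyE (n : nat) (Q x : C) :
  (qbernoulli_poly n Q).[x] =
  n`!%:R * fps_mul (qbernoulli_gf Q) (fps_exp x) n.
Proof.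
rewrite /qbernoulli_poly /fps_mul horner_sum mulr_sumr.
apply: eq_bigr => -[j /=]; rewrite ltnS => le_jn _.
rewrite hornerZ hornerXn /qbernoulli_num /fps_exp -(bin_fact le_jn) !natrM.
have nf0 : (n - j)`!%:R != 0 :> C by rewrite Cp_natr_neq0 ?fact_gt0.
rewrite -!mulrA; congr (_ * (_ * _)); rewrite mulrCA; congr (_ * _).
by rewrite mulrCA divff // mulr1.
Qed.

End QBernoulli.

(* Main.v *)
From HB Require Import structures.
Require Import Defs.
From mathcomp Require Import all_boot all_order all_algebra.
From mathcomp Require Import all_classical all_reals all_analysis.
From mathcomp Require Import ring lra.

Import Order.TTheory GRing.Theory Num.Theory.
Local Open Scope ring_scope.

(** Write [U_m = q^m e^(m t) - 1] and [W = w1 w2 w3].  Summing the geometric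
    series hidden in the power sums and in the sums over [i], each of the six
    expressions is [n!] times the coefficient of [t^n] in
    [(log q + t) e^(W y t) U_W^2 / (U_(w1 w2) U_(w1 w3) U_(w2 w3))],
    which is symmetric in [w1, w2, w3].  The arithmetic input is that
    [q^m <> 1], so that the [U_m] are invertible, and that
    [log (q^m) = m log q].  The former holds because [q |-> q^p] scales
    [|q - 1|] by exactly [1/p] on the disc, while exponents prime to [p]
    preserve it; the latter follows from
    [log x = lim (x^(p^N) - 1) / p^N]. *)

(** * Nonarchimedean absolute values *)

Section NonarchAbsval.
Context {R : realType} {K : fieldType} {v : K -> R} (hv : nonarch_absval v).

Lemma absval0 : v 0 = 0. Proof. exact/(absval_eq0 hv). Qed.

Lemma absval_gt0 x : x != 0 -> 0 < v x.
Proof.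
move=> x0; rewrite lt0r (absval_ge0 hv) andbT.
by apply: contra_neq x0 => /(absval_eq0 hv).
Qed.

Lemma absval1 : v 1 = 1.
Proof.
have v1 : v 1 != 0 by rewrite gt_eqF// absval_gt0// oner_neq0.
by apply: (mulfI v1); rewrite -(absvalM hv) !mulr1.
Qed.

Lemma absvalN x : v (- x) = v x.
Proof.
suff vN1 : v (-1) = 1 by rewrite -mulN1r (absvalM hv) vN1 mul1r.
apply/eqP; rewrite -(@eqrXn2 _ 2) ?(absval_ge0 hv)// expr1n expr2.
by rewrite -(absvalM hv) mulN1r opprK absval1.
Qed.

Lemma absval_distC x y : v (x - y) = v (y - x).
Proof. by rewrite -absvalN opprB. Qed.

Lemma absvalX x n : v (x ^+ n) = v x ^+ n.
Proof. by elim: n => [|n IH]; rewrite ?expr0 ?absval1// !exprS (absvalM hv) IH. Qed.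

Lemma absvalV x : v x^-1 = (v x)^-1.
Proof.
have [->|x0] := eqVneq x 0; first by rewrite invr0 absval0 invr0.
by apply: divr1_eq; rewrite invrK -(absvalM hv) mulVf// absval1.
Qed.

Lemma absvalD_le x y B : v x <= B -> v y <= B -> v (x + y) <= B.
Proof. by move=> xB yB; apply: le_trans (absvalD hv _ _) _; rewrite ge_max xB. Qed.

Lemma absval_dist_le x y z B : v (x - y) <= B -> v (y - z) <= B -> v (x - z) <= B.
Proof.
by move=> xy yz; rewrite -(subrK y x) -addrA; apply: absvalD_le.
Qed.

Lemma absval_sum_le (I : eqType) (r : seq I) (P : pred I) (F : I -> K) (B : R) :
  0 <= B -> (forall i, i \in r -> P i -> v (F i) <= B) ->
  v (\sum_(i <- r | P i) F i) <= B.
Proof.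
move=> B0 FB; rewrite big_seq_cond.
elim/big_ind: _ => [|x y|i /andP[ri Pi]]; first by rewrite absval0.
  exact: absvalD_le.
exact: FB.
Qed.

Lemma absval_sum_lt (I : eqType) (r : seq I) (P : pred I) (F : I -> K) (B : R) :
  0 < B -> (forall i, i \in r -> P i -> v (F i) < B) ->
  v (\sum_(i <- r | P i) F i) < B.
Proof.
move=> B0 FB; rewrite big_seq_cond.
elim/big_ind: _ => [|x y xB yB|i /andP[ri Pi]]; first by rewrite absval0.
  by apply: le_lt_trans (absvalD hv _ _) _; rewrite gt_max xB.
exact: FB.
Qed.

Lemma absval_nat_le1 n : v n%:R <= 1.
Proof.
elim: n => [|n IH]; first by rewrite absval0.
by rewrite -natr1 absvalD_le// absval1.
Qed.

(** If [x + y] were strictly smaller than [x], then [x = (x + y) - y] would be smaller than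
    itself. *)
Lemma absval_dominant x y : v y < v x -> v (x + y) = v x.
Proof.
move=> yx; apply/le_anti; rewrite absvalD_le ?(ltW yx)//=.
rewrite leNgt; apply/negP => h.
have : v x < v x; last by rewrite ltxx.
rewrite -{1}(addrK y x); apply: le_lt_trans (absvalD hv _ _) _.
by rewrite gt_max h absvalN.
Qed.

(** In [x ^+ n - 1 = (x - 1) * \sum_(i < n) x ^+ i] the cofactor has absolute value at most 1, since
    [v x <= 1]. *)
Lemma absvalX_sub1_le x n : v (x - 1) <= 1 -> v (x ^+ n - 1) <= v (x - 1).
Proof.
move=> x1; rewrite subrX1 (absvalM hv) ler_piMr ?(absval_ge0 hv)//.
apply: absval_sum_le => // i _ _; rewrite absvalX exprn_ile1 ?(absval_ge0 hv)//.
by rewrite -(subrK 1 x) absvalD_le// absval1.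
Qed.

Lemma vcvgP u l : vcvg v u l <->
  forall e : R, 0 < e -> exists N, forall n, (N <= n)%N -> v (u n - l) < e.
Proof.
rewrite /vcvg; split => [/cvgr0Pnorm_lt h e e0|h].
  have [N _ hN] := h e e0; exists N => n Nn.
  by have := hN n Nn; rewrite /= ger0_norm ?(absval_ge0 hv).
apply/cvgr0Pnorm_lt => e /h[N hN]; exists N => // n Nn /=.
by rewrite ger0_norm ?(absval_ge0 hv)// hN.
Qed.

Lemma vlimP u l : vcvg v u l -> vcvg v u (vlim v u).
Proof. by move=> ul; rewrite /vlim; case: xgetP => [? -> //|/(_ l)]. Qed.

(** Closed balls are closed: this carries uniform bounds on partial sums over to their limit. *)
Lemma vcvg_dist_le u l y B N : vcvg v u l ->
  (forall n, (N <= n)%N -> v (u n - y) <= B) -> v (l - y) <= B.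
Proof.
move=> /vcvgP ul uB; apply/ler_addgt0Pr => e e0.
have B0 : 0 <= B by apply: le_trans (uB N (leqnn _)); apply: absval_ge0.
have [N' ul'] := ul e e0; set n := maxn N N'.
apply: (@absval_dist_le _ (u n)).
  by rewrite absval_distC (le_trans (ltW (ul' n (leq_maxr _ _))))// lerDr.
by rewrite (le_trans (uB n (leq_maxl _ _)))// lerDl ltW.
Qed.

End NonarchAbsval.

(** * Real estimates for error terms *)

Section RealBounds.
Context {R : realType}.
Implicit Types (r B x : R) (p : nat).

(** Powers of [r] decrease, so [n * r ^+ n] is at most the geometric sum of the first [n] powers,
    hence at most [1 / (1 - r)]. *)
Lemma natr_mulX_bounded r : 0 <= r < 1 -> exists B, forall n, n%:R * r ^+ n <= B.
Proof.
move=> /andP[r0 r1]; exists (1 - r)^-1 => n.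
have r1' : 0 < 1 - r by rewrite subr_gt0.
rewrite -[leRHS]div1r ler_pdivlMr// mulrC.
have h : n%:R * r ^+ n <= \sum_(i < n) r ^+ i.
  rewrite -[n in n%:R]card_ord -sum1_card natr_sum mulr_suml.
  by apply: ler_sum => i _; rewrite mul1r ler_wiXn2l ?(ltW r1)// ltnW.
apply: le_trans (ler_wpM2l (ltW r1') h) _.
have -> : (1 - r) * (\sum_(i < n) r ^+ i) = 1 - r ^+ n.
  by rewrite -[RHS]opprB subrX1 -mulNr opprB.
by rewrite gerBl exprn_ge0.
Qed.

(** The square of the previous bound, taken at the square root of [r]. *)
Lemma natr_sqr_mulX_bounded r : 0 <= r < 1 ->
  exists2 B, 0 <= B & forall n, n%:R ^+ 2 * r ^+ n <= B.
Proof.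
move=> /andP[r0 r1].
have [|B hB] := @natr_mulX_bounded (Num.sqrt r).
  by rewrite sqrtr_ge0 -sqrtr1 ltr_sqrt.
exists (B ^+ 2) => [|n]; first exact: sqr_ge0.
have -> : n%:R ^+ 2 * r ^+ n = (n%:R * Num.sqrt r ^+ n) ^+ 2.
  by rewrite exprMn -exprM mulnC exprM sqr_sqrtr.
by rewrite lerXn2r ?nnegrE// ?(le_trans _ (hB n))// mulr_ge0// exprn_ge0// sqrtr_ge0.
Qed.

(** Turns estimates with error [B * p ^- N] for all [N] into exact statements. For [x > 0], some
    [n > B / x] gives [p ^ n > n > B / x], a contradiction. *)
Lemma le0_of_le_geometric p x B : (1 < p)%N ->
  (forall n, x <= B * p%:R ^- n) -> x <= 0.
Proof.
move=> p1 xB; rewrite leNgt; apply/negP => x0.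
have [n hn] : exists n : nat, B / x < n%:R.
  exists (Num.bound `|B / x|); exact: le_lt_trans (ler_norm _) (archi_boundP (normr_ge0 _)).
have pn0 : 0 < p%:R ^+ n :> R by rewrite exprn_gt0// ltr0n ltnW.
have := xB n; rewrite ler_pdivlMr// mulrC leNgt => /negP; apply.
rewrite -ltr_pdivrMr// (lt_le_trans hn)// -natrX ler_nat ltnW//.
exact: ltn_expl.
Qed.

End RealBounds.

(** * The p-adic logarithm of a power *)

(** The binomial expansion around 1 with its linear term split off, so that this term can be shown
    to dominate. *)
Lemma exprS_sub1E (A : comNzRingType) (x : A) n :
  x ^+ n.+1 - 1 =
  n.+1%:R * (x - 1) + \sum_(i < n) 'C(n.+1, i.+2)%:R * (x - 1) ^+ i.+2.
Proof.
rewrite -{1}(subrK 1 x) [_ - 1 + 1]addrC exprDn.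
rewrite 2!big_ord_recl /= !expr1n !mul1r bin0 expr0 addrC addKr.
rewrite /bump /= bin1 expr1 mulr_natl; congr (_ + _).
by apply: eq_bigr => i _; rewrite expr1n mul1r !add1n -mulr_natl.
Qed.

Section PadicLogarithm.
Context {R : realType} {p : nat} (p_prime : prime p) (C : padic_complex R p).
Implicit Types x : C.

Let v : C -> R := @Cp_abs R p C.

Let hv : nonarch_absval v.
Proof. exact: completion_absval (Cp_completion C). Qed.

Let p_gt0 : 0 < p%:R :> R.
Proof. by rewrite ltr0n prime_gt0. Qed.

(** * Absolute values of integers and binomial coefficients *)

Lemma Cp_abs_natr n : (0 < n)%N -> v n%:R = p%:R ^- logn p n.
Proof.
move=> n0; rewrite /v -(rmorph_nat (Cp_of_Qpbar C)).
rewrite (completion_isometry (Cp_completion C)).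
rewrite -(rmorph_nat (Qpbar_of_Qp C)) Qpbar_extends.
rewrite -(rmorph_nat (Qp_of_rat C)) (completion_isometry (Qp_completion C)).
rewrite /padic_norm pnatr_eq0 gtn_eqF//.
have -> : n%:R = (Posz n)%:~R :> rat by [].
by rewrite numq_int denq_int /= logn1 sub0r -exprnN.
Qed.

Lemma Cp_abs_prime_exp n : v (p ^ n)%:R = p%:R ^- n.
Proof. by rewrite Cp_abs_natr ?expn_gt0 ?prime_gt0// pfactorK. Qed.

(** The [p]-part of [n] divides [n], so it is at most [n]. This controls the denominators of the
    logarithm series. *)
Lemma Cp_abs_natr_ge n : (0 < n)%N -> n%:R^-1 <= v n%:R.
Proof.
move=> n0; rewrite Cp_abs_natr// lef_pV2 ?posrE ?exprn_gt0// ?ltr0n//.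
by rewrite -natrX ler_nat dvdn_leq// pfactor_dvdnn.
Qed.

Lemma Cp_abs_natrV_le n : v n%:R^-1 <= n%:R.
Proof.
case: n => [|n]; first by rewrite invr0 (absval0 hv).
rewrite (absvalV hv) -[leRHS]invrK lef_pV2 ?posrE ?Cp_abs_natr_ge//.
by rewrite (absval_gt0 hv)// Cp_natr_neq0.
Qed.

(** Induction on [m]. With [P = p ^ N], Pascal's rule and absorption give [C(P-1, m+1) + C(P-1, m) =
    P / (m+1) * C(P-1, m)], and the right side has absolute value at most [(m+1) * p ^- N]. *)
Lemma Cp_abs_bin_prime_exp N m :
  v ('C((p ^ N).-1, m)%:R - (-1) ^+ m) <= m%:R * p%:R ^- N.
Proof.
set P := (p ^ N)%N; have P0 : (0 < P)%N by rewrite expn_gt0 prime_gt0.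
elim: m => [|m IH]; first by rewrite bin0 subrr (absval0 hv) mul0r.
have -> : 'C(P.-1, m.+1)%:R - (-1) ^+ m.+1 =
    P%:R * m.+1%:R^-1 * 'C(P.-1, m)%:R - ('C(P.-1, m)%:R - (-1) ^+ m) :> C.
  have h : m.+1%:R * ('C(P.-1, m.+1)%:R + 'C(P.-1, m)%:R) = P%:R * 'C(P.-1, m)%:R :> C.
    by rewrite -natrD -!natrM -binS prednK// mul_bin_diag.
  have m0 : m.+1%:R != 0 :> C by rewrite Cp_natr_neq0.
  rewrite mulrAC -h mulrAC divff// mul1r exprS; ring.
have pN0 : 0 <= p%:R ^- N :> R by rewrite invr_ge0 exprn_ge0// ltW.
apply: (absvalD_le hv); last first.
  by rewrite (absvalN hv) (le_trans IH)// ler_wpM2r// ler_nat.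
rewrite !(absvalM hv) Cp_abs_prime_exp -mulrA mulrC ler_wpM2r//.
by rewrite -[leRHS]mulr1 ler_pM ?(absval_ge0 hv) ?(absval_nat_le1 hv) ?Cp_abs_natrV_le.
Qed.

Definition log_partial_sum x M : C :=
  \sum_(1 <= n < M) (-1) ^+ n.-1 * (x - 1) ^+ n / n%:R.

(* Converges to log x as N grows, and turns x^w into an exact multiple, see
   log_quotientX. *)
Definition log_quotient x N : C := (x ^+ (p ^ N) - 1) / (p ^ N)%:R.

(** The binomial theorem for [1 + (x - 1)], combined with [C(P, n) / P = C(P-1, n-1) / n]. Any
    [M > P] is allowed because the binomials vanish beyond [P]; this lines the sum up with
    [log_partial_sum x M]. *)
Lemma log_quotientE x N M : (p ^ N < M)%N ->
  log_quotient x N =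
  \sum_(1 <= n < M) 'C((p ^ N).-1, n.-1)%:R * (x - 1) ^+ n / n%:R.
Proof.
rewrite /log_quotient; set P := (p ^ N)%N => PM.
have P0 : (0 < P)%N by rewrite expn_gt0 prime_gt0.
have -> : x ^+ P - 1 = \sum_(1 <= n < M) 'C(P, n)%:R * (x - 1) ^+ n.
  rewrite -{1}(addrNK 1 x) [_ - 1 + 1]addrC exprDn.
  rewrite -(big_mkord xpredT (fun i => (1 ^+ (P - i) * (x - 1) ^+ i) *+ 'C(P, i))).
  rewrite [RHS](@big_cat_nat _ _ _ P.+1)//= [X in _ = _ + X]big1_seq ?addr0; last first.
    by move=> i; rewrite mem_index_iota => /andP[_ /andP[Pi _]]; rewrite bin_small// mul0r.
  rewrite big_ltn// bin0 expr0 expr1n mulr1 addrC addKr.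
  by apply: eq_bigr => i _; rewrite expr1n mul1r mulr_natl.
rewrite mulr_suml; apply: eq_big_nat => -[|n]// _ /=.
have n0 : n.+1%:R != 0 :> C by rewrite Cp_natr_neq0.
have P0' : P%:R != 0 :> C by rewrite Cp_natr_neq0.
have h : n.+1%:R * 'C(P, n.+1)%:R = P%:R * 'C(P.-1, n)%:R :> C.
  by rewrite -!natrM mul_bin_diag.
rewrite -['C(P, n.+1)%:R](mulKf n0) h {h}.
by move: n.+1%:R P%:R n0 P0' => a b a0 b0; field; rewrite a0.
Qed.

(* Since C(P-1, n-1) is close to (-1)^(n-1) for P = p^N, and |1/n| <= n, the
   terms of the two sums differ by at most n^2 |x-1|^n p^-N. *)
Lemma log_quotient_bounded x : v (x - 1) < 1 ->
  exists2 B, 0 <= B & forall N M, (p ^ N < M)%N ->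
    v (log_partial_sum x M - log_quotient x N) <= B * p%:R ^- N.
Proof.
move=> x1; have [|B B0 hB] := @natr_sqr_mulX_bounded _ (v (x - 1)).
  by rewrite x1 (absval_ge0 hv).
exists B => // N M NM; rewrite (log_quotientE _ _ _ NM) /log_partial_sum -sumrB.
have pN0 : 0 <= p%:R ^- N :> R by rewrite invr_ge0 exprn_ge0// ltW.
apply: (absval_sum_le hv) => [|n _ _]; first exact: mulr_ge0.
rewrite -mulrBl -mulrBl !(absvalM hv) (absval_distC hv) (absvalX hv).
apply: (@le_trans _ _ (n%:R * p%:R ^- N * v (x - 1) ^+ n * n%:R)).
  rewrite ler_pM ?mulr_ge0 ?exprn_ge0 ?(absval_ge0 hv) ?Cp_abs_natrV_le//.
  rewrite ler_wpM2r ?exprn_ge0 ?(absval_ge0 hv)//.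
  by rewrite (le_trans (Cp_abs_bin_prime_exp _ _))// ler_wpM2r// ler_nat leq_pred.
rewrite [leLHS](_ : _ = (n%:R ^+ 2 * v (x - 1) ^+ n) * p%:R ^- N); last by ring.
by rewrite ler_wpM2r.
Qed.

Lemma padic_log_quotient x : v (x - 1) < 1 ->
  exists2 B, 0 <= B & forall N, v (padic_log x - log_quotient x N) <= B * p%:R ^- N.
Proof.
move=> x1; have [B B0 hB] := log_quotient_bounded _ x1; exists B => // N.
(* Since [vlim] is 0 on divergent sequences, the existence of a limit comes first; the bound then
   passes to it. *)
suff [l cvl] : exists l, vcvg v (log_partial_sum x) l.
  exact: (vcvg_dist_le hv _ _ _ _ (p ^ N).+1 (vlimP _ _ cvl) (hB N)).
apply: (completion_complete (Cp_completion C)) => e e0.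
have [N' hN'] : exists N', B * p%:R ^- N' < e.
  apply: contrapT => /forallNP h.
  suff : e <= 0 by rewrite leNgt e0.
  apply: (le0_of_le_geometric _ _ _ (prime_gt1 p_prime)) => k.
  by rewrite leNgt; apply/negP/h.
(* Beyond [p ^ N'] all partial sums are close to the same [log_quotient x N'], hence to each
   other. *)
exists (p ^ N').+1 => m n Nm Nn; apply: le_lt_trans hN'.
by apply: (absval_dist_le hv _ _ _ _ (hB _ _ Nm)); rewrite (absval_distC hv) hB.
Qed.

(** The geometric factor tends to [w], because [x ^+ (p ^ N)] tends to 1 when [v (x - 1) < 1]. *)
Lemma log_quotientX x N w : log_quotient (x ^+ w) N =
  log_quotient x N * \sum_(i < w) (x ^+ (p ^ N)) ^+ i.
Proof. by rewrite /log_quotient -exprM mulnC exprM subrX1 mulrAC. Qed.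

(** Passes from [padic_log (x ^+ w)] through [log_quotient (x ^+ w) N] and [w * log_quotient x N] to
    [w * padic_log x]; each distance is [O(p ^- N)]. *)
Lemma padic_logX x w : v (x - 1) < 1 -> padic_log (x ^+ w) = w%:R * padic_log x.
Proof.
move=> x1; have xw1 : v (x ^+ w - 1) < 1.
  by rewrite (le_lt_trans _ x1)// (absvalX_sub1_le hv)// ltW.
have [B B0 hB] := padic_log_quotient _ x1.
have [B' B'0 hB'] := padic_log_quotient _ xw1.
apply/eqP; rewrite -subr_eq0; apply/eqP/(absval_eq0 hv)/le_anti.
rewrite (absval_ge0 hv) andbT.
(* [L] bounds [log_quotient x N] uniformly in [N]. *)
pose L := v (padic_log x) + B; have L0 : 0 <= L by rewrite addr_ge0// (absval_ge0 hv).
(* The constants [B'], [L ^+ 2] and [B] come from the first, middle and last of the three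
   distances. *)
apply: (@le0_of_le_geometric _ p _ (B + B' + L ^+ 2) (prime_gt1 p_prime)) => N.
have pN0 : 0 <= p%:R ^- N :> R by rewrite invr_ge0 exprn_ge0// ltW.
have pN1 : p%:R ^- N <= 1 :> R.
  by rewrite invf_le1 ?exprn_gt0// exprn_ege1// ler1n prime_gt0.
have LB : L ^+ 2 >= 0 by apply: sqr_ge0.
apply: (absval_dist_le hv _ (log_quotient (x ^+ w) N)).
  by rewrite (le_trans (hB' N))// ler_wpM2r//; lra.
apply: (absval_dist_le hv _ (w%:R * log_quotient x N)); last first.
  rewrite -mulrBr (absvalM hv) -[leRHS]mul1r.
  rewrite ler_pM ?(absval_ge0 hv) ?(absval_nat_le1 hv)//.
  by rewrite (absval_distC hv) (le_trans (hB N))// ler_wpM2r//; lra.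
have vA : v (log_quotient x N) <= L.
  rewrite -(subrK (padic_log x) (log_quotient x N)).
  apply: (absvalD_le hv); last by rewrite lerDl.
  rewrite (absval_distC hv) (le_trans (hB N))//.
  by rewrite (le_trans (ler_piMr B0 pN1))// lerDr (absval_ge0 hv).
have vu : v (x ^+ (p ^ N) - 1) <= L * p%:R ^- N.
  have -> : x ^+ (p ^ N) - 1 = log_quotient x N * (p ^ N)%:R.
    by rewrite /log_quotient divfK// Cp_natr_neq0// expn_gt0 prime_gt0.
  by rewrite (absvalM hv) Cp_abs_prime_exp ler_wpM2r.
apply: (@le_trans _ _ (L * (L * p%:R ^- N))); last first.
  by rewrite mulrA -expr2 ler_wpM2r//; lra.
rewrite log_quotientX [w%:R * _]mulrC -mulrBr (absvalM hv).
rewrite ler_pM ?(absval_ge0 hv)//.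
(* Writing [w] as a sum of [w] ones pairs each with a power of [x ^+ (p ^ N)]; every difference is
   at most [v (x ^+ (p ^ N) - 1)]. *)
rewrite -[w in w%:R]card_ord -sum1_card natr_sum -sumrB.
apply: (absval_sum_le hv) => [|i _ _]; first exact: mulr_ge0.
apply: le_trans vu; apply: (absvalX_sub1_le hv).
by rewrite (le_trans (absvalX_sub1_le hv _ _ _))// ltW.
Qed.

(** * Absence of nontrivial roots of unity close to 1 *)

(** With [z = x - 1], the linear term [p * z] strictly dominates the expansion of
    [(1 + z) ^ p - 1]. *)
Lemma Cp_expr_prime_sub1_abs x : v (x - 1) ^+ p.-1 < p%:R^-1 ->
  v (x ^+ p - 1) = p%:R^-1 * v (x - 1).
Proof.
move=> xp; have p1 := prime_gt1 p_prime.
set z := x - 1; have [z0|z0] := eqVneq z 0.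
  by rewrite z0 (absval0 hv) mulr0 -(subrK 1 x) -/z z0 add0r expr1n subrr (absval0 hv).
have vz0 := absval_gt0 hv _ z0.
have vp : v p%:R = p%:R^-1 by rewrite Cp_abs_natr ?prime_gt0// logn_prime// eqxx.
have z1 : v z < 1.
  rewrite ltNge; apply/negP => z1; move: xp; rewrite ltNge => /negP; apply.
  by rewrite (le_trans _ (exprn_ege1 _ z1))// invf_le1// ler1n ltnW.
have -> : x ^+ p - 1 = p%:R * z + \sum_(i < p.-1) 'C(p, i.+2)%:R * z ^+ i.+2.
  by have := exprS_sub1E _ x p.-1; rewrite (prednK (ltnW p1)).
have vz_pos := absval_ge0 hv z.
have pz0 : 0 < p%:R^-1 * v z by rewrite mulr_gt0// invr_gt0.
rewrite (absval_dominant hv) (absvalM hv) vp//.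
apply: (absval_sum_lt hv) => // i _ _; rewrite (absvalM hv) (absvalX hv) exprSr mulrA.
(* After cancelling [v z], the middle terms have a factor [p] from the binomial and a further power
   of [z]. The last term, [z ^+ p], is where the hypothesis on [v z ^+ p.-1] enters. *)
rewrite ltr_pM2r//; have [ip|ip] := ltnP i.+2 p.
  rewrite (@le_lt_trans _ _ (p%:R^-1 * v z ^+ i.+1))//; last first.
    by rewrite gtr_pMr ?invr_gt0// exprn_ilt1.
  rewrite ler_wpM2r ?exprn_ge0//.
  have /dvdnP[k ->] : (p %| 'C(p, i.+2))%N by rewrite prime_dvd_bin.
  by rewrite natrM (absvalM hv) vp ler_piMl ?invr_ge0 ?(ltW p_gt0)// (absval_nat_le1 hv).
have ip' : i.+1 = p.-1 by apply/eqP; rewrite eqn_leq ltn_ord /= -ltnS (prednK (ltnW p1)).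
rewrite ip'; apply: le_lt_trans xp.
by rewrite ler_piMl ?exprn_ge0// (absval_nat_le1 hv).
Qed.

(** The cofactor [\sum_(i < w) x ^+ i] is [w], of absolute value 1, plus terms [x ^+ i - 1] of
    absolute value below 1. *)
Lemma Cp_expr_coprime_sub1_abs x w : v (x - 1) < 1 -> ~~ (p %| w)%N ->
  v (x ^+ w - 1) = v (x - 1).
Proof.
move=> x1 pw; rewrite subrX1 (absvalM hv).
suff -> : v (\sum_(i < w) x ^+ i) = 1 by rewrite mulr1.
have w0 : (0 < w)%N by case: w pw => //; rewrite dvdn0.
have vw : v w%:R = 1.
  by rewrite Cp_abs_natr// lognE p_prime w0 (negPf pw) expr0 invr1.
have -> : \sum_(i < w) x ^+ i = w%:R + \sum_(i < w) (x ^+ i - 1).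
  by rewrite sumrB sumr_const card_ord addrC subrK.
rewrite (absval_dominant hv)// vw; apply: (absval_sum_lt hv) => // i _ _.
by rewrite (le_lt_trans _ x1)// (absvalX_sub1_le hv)// ltW.
Qed.

(** Strong induction on [w] with [x] varying: when [p] divides [w], replace [x] by [x ^+ p], which
    differs from 1 and stays in the disc. Otherwise the distance to 1 is preserved. *)
Lemma Cp_expr_neq1 x w : x != 1 -> v (x - 1) ^+ p.-1 < p%:R^-1 ->
  (0 < w)%N -> x ^+ w != 1.
Proof.
have vp : p%:R^-1 < 1 :> R by rewrite invf_lt1// ltr1n prime_gt1.
elim/ltn_ind: w x => w IH x x_neq1 xp w0.
have vx : 0 < v (x - 1) by rewrite (absval_gt0 hv)// subr_eq0.
have x1 : v (x - 1) < 1.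
  rewrite ltNge; apply/negP => x1; move: xp; rewrite ltNge => /negP; apply.
  by rewrite (le_trans (ltW vp))// exprn_ege1.
have [/dvdnP[k wE]|pw] := boolP (p %| w)%N; last first.
  rewrite -subr_eq0; apply/eqP => /(absval_eq0 hv).
  by rewrite Cp_expr_coprime_sub1_abs// => /eqP; rewrite gt_eqF.
have k0 : (0 < k)%N by move: w0; rewrite wE muln_gt0 => /andP[].
have vxp := Cp_expr_prime_sub1_abs _ xp.
rewrite wE mulnC exprM IH//.
- by rewrite wE ltn_Pmulr// prime_gt1.
- rewrite -subr_eq0; apply/eqP => /(absval_eq0 hv)/eqP.
  by rewrite vxp gt_eqF// mulr_gt0// invr_gt0.
rewrite vxp; apply: le_lt_trans xp; rewrite lerXn2r ?nnegrE ?(ltW vx)//.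
  by rewrite mulr_ge0// ?invr_ge0 ltW.
by rewrite ler_piMl// ltW.
Qed.

Lemma powR_lt_exprn (r : R) : 0 <= r -> r < p%:R `^ (- (p%:R - 1)^-1) ->
  r ^+ p.-1 < p%:R^-1.
Proof.
move=> r0 rp; have p1 := prime_gt1 p_prime.
have pE : p.-1%:R = p%:R - 1 :> R by rewrite -subn1 natrB// ltnW.
have pm0 : p.-1%:R != 0 :> R by rewrite pnatr_eq0 -lt0n -ltnS (prednK (ltnW p1)).
have -> : p%:R^-1 = (p%:R `^ (- (p%:R - 1)^-1)) ^+ p.-1 :> R.
  by rewrite -powR_mulrn ?powR_ge0// -powRrM -pE mulNr mulVf// powR_inv1// ltW.
by rewrite ltrXn2r ?nnegrE// ?powR_ge0// -lt0n -ltnS (prednK (ltnW p1)).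
Qed.
End PadicLogarithm.

(** * The ring of formal power series *)

(** A synonym of [nat -> K] that carries the Cauchy product instead of the pointwise one. *)
Definition fps (K : fieldType) : Type := nat -> K.

Section FpsRing.
Context {K : fieldType}.
Implicit Types a b c : nat -> K.

Definition fps_one : nat -> K := fun n => (n == 0%N)%:R.

(** Truncation to polynomials transfers the ring laws from [{poly K}]. *)
Lemma fps_mul_coef a b N n : (n < N)%N ->
  fps_mul a b n = ((\poly_(i < N) a i) * (\poly_(i < N) b i))`_n.
Proof.
move=> nN; rewrite coefM; apply: eq_bigr => i _.
rewrite !coef_poly (leq_ltn_trans (leq_subr _ _) nN).
by rewrite (leq_ltn_trans _ nN)// -ltnS.
Qed.

Lemma fps_mulC : commutative (@fps_mul K).
Proof.
by move=> a b; apply/funext => n; rewrite !(fps_mul_coef _ _ _ _ (ltnSn n)) mulrC.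
Qed.

Lemma fps_mulA : associative (@fps_mul K).
Proof.
have h a b c n : fps_mul (fps_mul a b) c n =
    (\poly_(i < n.+1) a i * \poly_(i < n.+1) b i * \poly_(i < n.+1) c i)`_n.
  rewrite coefM; apply: eq_bigr => i _.
  by rewrite (fps_mul_coef _ _ _ _ (ltn_ord i)) coef_poly ltnS leq_subr.
by move=> a b c; apply/funext => n; rewrite fps_mulC !h [in LHS]mulrC mulrA.
Qed.

Lemma fps_mul1 : left_id fps_one (@fps_mul K).
Proof.
move=> a; apply/funext => n; rewrite /fps_mul big_ord_recl /= mul1r subn0.
by rewrite big1 ?addr0// => i _; rewrite mul0r.
Qed.

Lemma fps_mulDl : left_distributive (@fps_mul K) +%R.
Proof.
move=> a b c; apply/funext => n; transitivity (fps_mul a c n + fps_mul b c n) => //.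
rewrite /fps_mul -big_split /=.
by apply: eq_bigr => i _; rewrite -mulrDl.
Qed.

Lemma fps_one_neq0 : fps_one != 0.
Proof. by apply/eqP => /(congr1 (@^~ 0%N)) /eqP; rewrite /fps_one oner_eq0. Qed.

End FpsRing.

HB.instance Definition _ (K : fieldType) := GRing.Zmodule.copy (fps K) (nat -> K).
HB.instance Definition _ (K : fieldType) :=
  GRing.Zmodule_isComNzRing.Build (fps K)
    fps_mulA fps_mulC fps_mul1 fps_mulDl fps_one_neq0.

Section FpsTheory.
Context {K : fieldType}.
Implicit Types a b c : fps K.

Lemma fpsB a b n : (a - b) n = a n - b n. Proof. by []. Qed.

Lemma fps_sum I (r : seq I) (P : pred I) (F : I -> fps K) n :
  (\sum_(i <- r | P i) F i) n = \sum_(i <- r | P i) F i n.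
Proof. exact: (big_morph (fun a : fps K => a n)). Qed.

Lemma fps_mulE a b : a * b = fps_mul a b. Proof. by []. Qed.

(* Typed in [fps K] so that products are not taken pointwise in [nat -> K]. *)
Definition fpsV a : fps K := fps_inv a.

Lemma fps_mulVr a : a 0%N != 0 -> a * fpsV a = 1.
Proof. by move=> a0; rewrite mulrC; exact: fps_mulVf. Qed.

Definition fpsC (z : K) : fps K := fun n => if n is 0%N then z else 0.

Lemma fpsC_mul z a n : (fpsC z * a) n = z * a n.
Proof.
rewrite fps_mulE /fps_mul big_ord_recl /= subn0.
by rewrite big1 ?addr0// => i _; rewrite mul0r.
Qed.

Lemma fpsCM : {morph fpsC : x y / x * y}.
Proof. by move=> x y; apply/funext => n; rewrite fpsC_mul; case: n; rewrite //= mulr0. Qed.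

Lemma fpsC1 : fpsC 1 = 1. Proof. by apply/funext => -[]. Qed.

Lemma fpsCX z n : fpsC (z ^+ n) = fpsC z ^+ n.
Proof. by elim: n => [|n IH]; rewrite ?fpsC1// !exprS fpsCM IH. Qed.

(* a(z t) *)
Definition fps_scale (z : K) a : fps K := fun n => z ^+ n * a n.

Lemma fps_scaleM z : {morph fps_scale z : a b / a * b}.
Proof.
move=> a b; apply/funext => n; rewrite /fps_scale !fps_mulE /fps_mul mulr_sumr.
apply: eq_bigr => i _; rewrite mulrACA -exprD subnKC//.
by rewrite -ltnS.
Qed.

Lemma fps_scaleB z : {morph fps_scale z : a b / a - b}.
Proof. by move=> a b; apply/funext => n; rewrite /fps_scale fpsB mulrBr. Qed.

Lemma fps_scaleC z x : fps_scale z (fpsC x) = fpsC x.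
Proof. by apply/funext => -[|n]; rewrite /fps_scale ?expr0 ?mul1r//= mulr0. Qed.

Lemma fps_scale1 z : fps_scale z 1 = 1.
Proof. by rewrite -fpsC1 fps_scaleC. Qed.

Lemma fps_scale_exp z x : fps_scale z (fps_exp x) = fps_exp (z * x).
Proof. by apply/funext => n; rewrite /fps_scale /fps_exp exprMn mulrA. Qed.

Hypothesis K_char0 : forall n, (0 < n)%N -> n%:R != 0 :> K.

Let fact_neq0 n : n`!%:R != 0 :> K. Proof. by rewrite K_char0 ?fact_gt0. Qed.

(** Products of exponential generating series are binomial convolutions; this produces the
    ['C(n, k)] of the theorem. *)
Lemma fact_fps_mul a b n : n`!%:R * (a * b) n =
  \sum_(k < n.+1) 'C(n, k)%:R * (k`!%:R * a k) * ((n - k)`!%:R * b (n - k)%N).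
Proof.
rewrite fps_mulE /fps_mul mulr_sumr; apply: eq_bigr => -[k /=]; rewrite ltnS => kn _.
rewrite -(bin_fact kn) !natrM; ring.
Qed.

Lemma fact_fps_exp (x : K) n : n`!%:R * fps_exp x n = x ^+ n.
Proof. by rewrite /fps_exp mulrC divfK. Qed.

Lemma fps_expD (x y : K) : fps_exp (x + y) = (fps_exp x : fps K) * fps_exp y.
Proof.
apply/funext => n; apply: (mulfI (fact_neq0 n)); rewrite fact_fps_mul.
rewrite fact_fps_exp addrC exprDn; apply: eq_bigr => k _.
by rewrite !fact_fps_exp -mulrA mulr_natl mulrC.
Qed.

Lemma fps_exp0 : fps_exp (0 : K) = (1 : fps K).
Proof.
apply/funext => -[|n]; first by rewrite /fps_exp expr0 fact0 divr1.
by rewrite /fps_exp expr0n mul0r.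
Qed.

Lemma fps_expMn (x : K) n : fps_exp (n%:R * x) = (fps_exp x : fps K) ^+ n.
Proof.
elim: n => [|n IH]; first by rewrite mul0r fps_exp0.
by rewrite -natr1 mulrDl mul1r fps_expD IH exprSr.
Qed.
End FpsTheory.

(** * Generating series *)

(** The exponents [n - 1] and [k - 1] are integers, equal to -1 at zero; as quotients they become
    accessible to [field]. *)
Lemma exprz_subr1 (K : fieldType) (x : K) (n : nat) :
  x != 0 -> x ^ (n%:Z - 1) = x ^+ n / x.
Proof. by move=> x0; rewrite expfzDr// exprN1. Qed.

Section QBernoulliSymmetry.
Context {R : realType} {p : nat} (p_prime : prime p) {C : padic_complex R p}.
Variable q : C.
Hypothesis q_neq1 : q != 1.
Hypothesis q_near1 : Cp_abs (q - 1) < p%:R `^ (- (p%:R - 1)^-1).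

Let char0 n : (0 < n)%N -> n%:R != 0 :> C := @Cp_natr_neq0 R p C n.

(* q^m e^(m t) *)
Definition qexp m : fps C := fpsC (q ^+ m) * fps_exp m%:R.

(* log q + t *)
Definition log_add_t : fps C :=
  fun n => if n is m.+1 then (m == 0%N)%:R else padic_log q.

Lemma qexpM m i : qexp (m * i) = qexp m ^+ i.
Proof. by rewrite /qexp exprMn -fps_expMn// -fpsCX -exprM mulnC natrM. Qed.

Lemma Cp_abs_q_lt : Cp_abs (q - 1) ^+ p.-1 < p%:R^-1.
Proof.
apply: powR_lt_exprn => //.
exact: absval_ge0 (completion_absval (Cp_completion C)) _.
Qed.

Lemma qexp_sub1_unit m : (0 < m)%N -> (qexp m - 1) 0%N != 0.
Proof.
move=> m0; rewrite fpsB /qexp fpsC_mul /fps_exp expr0 divr1 mulr1 subr_eq0.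
exact: (Cp_expr_neq1 p_prime C q m q_neq1 Cp_abs_q_lt m0).
Qed.

(** Replacing [t] by [m t] turns the denominator into [qexp m - 1] and the numerator into
    [log (q ^+ m) + m t = m (log q + t)]. *)
Lemma qbernoulli_gf_scale m : (0 < m)%N ->
  fps_scale m%:R (qbernoulli_gf (q ^+ m)) * (qexp m - 1) = fpsC m%:R * log_add_t.
Proof.
move=> m0; pose V : fps C := fpsC (q ^+ m) * fps_exp 1 - 1.
have VE : V = fun n => q ^+ m * fps_exp 1 n - (n == 0%N)%:R.
  by apply/funext => n; rewrite /V fpsB fpsC_mul.
have sV : fps_scale m%:R V = qexp m - 1.
  by rewrite fps_scaleB fps_scaleM fps_scaleC fps_scale_exp fps_scale1 mulr1.
have V0 : V 0%N != 0.
  by have := qexp_sub1_unit m m0; rewrite -sV /fps_scale expr0 mul1r.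
have -> : qbernoulli_gf (q ^+ m) =
    ((fun n => if n is k.+1 then (k == 0%N)%:R else padic_log (q ^+ m)) : fps C)
    * fpsV V by rewrite VE.
rewrite -sV -fps_scaleM -mulrA [fpsV V * V]mulrC fps_mulVr// mulr1.
(* Coefficients 0, 1 and at least 2 of the numerator; only the constant one needs the logarithm of a
   power. *)
apply/funext => -[|[|n]]; rewrite fpsC_mul /fps_scale ?expr0 ?mul1r//=.
- have q1 : Cp_abs (q - 1) < 1.
    rewrite ltNge; apply/negP => q1; have := Cp_abs_q_lt; rewrite ltNge => /negP; apply.
    rewrite (le_trans _ (exprn_ege1 _ q1))// invf_le1 ?ler1n ?ltr0n prime_gt0//.
  by rewrite padic_logX.
- by rewrite !mulr0.
Qed.

(** * The symmetric series and its coefficients *)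

Definition symmetric_series (y : C) (a b c : nat) : fps C :=
  log_add_t * fps_exp ((a * b * c)%:R * y) * (qexp (a * b * c) - 1) ^+ 2
  * (fpsV (qexp (a * b) - 1) * fpsV (qexp (a * c) - 1)
     * fpsV (qexp (b * c) - 1)).

(** This transposition and the next one generate all permutations of the three parameters. *)
Lemma symmetric_series_swapl y a b c :
  symmetric_series y a b c = symmetric_series y b a c.
Proof.
rewrite /symmetric_series [(b * a)%N]mulnC; congr (_ * _); exact: mulrAC.
Qed.

Lemma symmetric_series_swapr y a b c :
  symmetric_series y a b c = symmetric_series y a c b.
Proof.
rewrite /symmetric_series [(c * b)%N]mulnC mulnAC; congr (_ * (_ * _)).
exact: mulrC.
Qed.

(** Each factor [qexp (a * b * c) - 1] is a geometric sum times [qexp (b * c) - 1] or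
    [qexp (a * b) - 1]; the third denominator comes from [qbernoulli_gf_scale]. *)
Lemma symmetric_seriesE y a b c : (0 < a)%N -> (0 < b)%N -> (0 < c)%N ->
  fpsC (a * c)%:R^-1 * ((\sum_(i < a) qexp (b * c) ^+ i) *
    (fps_scale (a * c)%:R (qbernoulli_gf (q ^+ (a * c)))
     * fps_exp ((a * b * c)%:R * y)))
  * (\sum_(j < c) qexp (a * b) ^+ j) = symmetric_series y a b c.
Proof.
move=> a0 b0 c0.
have ab := qexp_sub1_unit (a * b) ltac:(by rewrite muln_gt0 a0).
have ac := qexp_sub1_unit (a * c) ltac:(by rewrite muln_gt0 a0).
have bc := qexp_sub1_unit (b * c) ltac:(by rewrite muln_gt0 b0).
have G := qbernoulli_gf_scale (a * c) ltac:(by rewrite muln_gt0 a0).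
have geo1 : qexp (a * b * c) - 1 =
    (qexp (b * c) - 1) * \sum_(i < a) qexp (b * c) ^+ i.
  by rewrite -subrX1 -qexpM -mulnA mulnC.
have geo2 : qexp (a * b * c) - 1 =
    (qexp (a * b) - 1) * \sum_(i < c) qexp (a * b) ^+ i.
  by rewrite -subrX1 -qexpM.
rewrite /symmetric_series expr2 {1}geo1 geo2.
set g := fps_scale _ _ in G *.
move: G (fps_mulVr _ ab) (fps_mulVr _ ac) (fps_mulVr _ bc).
have : fpsC (a * c)%:R^-1 * fpsC (a * c)%:R = 1 :> fps C.
  by rewrite -fpsCM mulVf ?fpsC1// char0// muln_gt0 a0.
move: (fpsV (qexp (a * b) - 1)) (fpsV (qexp (a * c) - 1)).
move: (fpsV (qexp (b * c) - 1)) => /= Ibc Iab Iac.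
(* Generalizing all series leaves an identity in a commutative ring, where each [U * I = 1] is
   inserted by hand. *)
move: (qexp (a * b) - 1) (qexp (a * c) - 1) (qexp (b * c) - 1) => Uab Uac Ubc.
move: log_add_t (fpsC (a * c)%:R^-1) (fpsC (a * c)%:R) (\sum_(i < _) _) (\sum_(i < _) _) (fps_exp _).
move=> L r s S1 S2 e rs gU ab1 ac1 bc1.
transitivity (r * (g * Uac) * S1 * S2 * e * Iac * (Uab * Iab) * (Ubc * Ibc)).
  rewrite ab1 bc1 !mulr1.
  transitivity (r * g * S1 * S2 * e * (Uac * Iac)); last by ring.
  by rewrite ac1; ring.
rewrite gU; transitivity ((r * s) * L * S1 * S2 * e * Iac * (Uab * Iab) * (Ubc * Ibc)).
  by ring.
by rewrite rs; ring.
Qed.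

Lemma qpower_sum_fps m w c : (0 < c)%N ->
  m`!%:R * (\sum_(j < c) qexp w ^+ j) m =
  w%:R ^+ m * qpower_sum m (q ^+ w) (c - 1).
Proof.
(* Since [c] is positive, the indices [0] to [c - 1] are exactly [c] many; truncated subtraction
   would leave one term at [c = 0]. *)
move=> c0; rewrite /qpower_sum subn1 prednK// fps_sum !mulr_sumr.
apply: eq_bigr => j _; rewrite -qexpM /qexp fpsC_mul mulrCA fact_fps_exp//.
by rewrite natrM exprMn exprM; ring.
Qed.

(** The exponents combine as [b c i + a b c y = a c (b y + (b / a) i)], so the rescaling by [a c]
    can be pulled out of the whole product. *)
Lemma qbernoulli_sum_fps k y a b c : (0 < a)%N ->
  k`!%:R * ((\sum_(i < a) qexp (b * c) ^+ i) *
    (fps_scale (a * c)%:R (qbernoulli_gf (q ^+ (a * c)))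
     * fps_exp ((a * b * c)%:R * y))) k =
  (a * c)%:R ^+ k * \sum_(i < a) q ^+ (b * c * i)
    * (qbernoulli_poly k (q ^+ (a * c))).[b%:R * y + b%:R / a%:R * i%:R].
Proof.
move=> a0; have a0' := char0 a a0.
rewrite mulr_suml fps_sum !mulr_sumr; apply: eq_bigr => i _.
rewrite qbernoulli_polyE -fps_mulE -qexpM /qexp.
have -> : fpsC (q ^+ (b * c * i)) * fps_exp (b * c * i)%:R *
    (fps_scale (a * c)%:R (qbernoulli_gf (q ^+ (a * c)))
     * fps_exp ((a * b * c)%:R * y)) =
  fpsC (q ^+ (b * c * i)) * fps_scale (a * c)%:R
    ((qbernoulli_gf (q ^+ (a * c)) : fps C)
     * fps_exp (b%:R * y + b%:R / a%:R * i%:R)).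
  rewrite fps_scaleM fps_scale_exp -mulrA; congr (_ * _).
  rewrite mulrCA -fps_expD//; congr (_ * _); congr (fps_exp _).
  by rewrite !natrM; field.
by rewrite fpsC_mul /fps_scale; ring.
Qed.

(** The powers of the parameters match because [(a c) ^ k (a b) ^ (n - k) / (a c) = a ^ (n - 1) b ^
    (n - k) c ^ (k - 1)]. *)
Lemma qbernoulli_symmetric_series n y a b c :
    (0 < a)%N -> (0 < b)%N -> (0 < c)%N ->
  a%:R ^ (n%:Z - 1) *
    \sum_(k < n.+1) 'C(n, k)%:R
      * qpower_sum (n - k) (q ^+ (a * b)) (c - 1)
      * b%:R ^+ (n - k) * c%:R ^ (k%:Z - 1)
      * \sum_(i < a) q ^+ (b * c * i)
          * (qbernoulli_poly k (q ^+ (a * c))).[b%:R * y + b%:R / a%:R * i%:R]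
  = n`!%:R * symmetric_series y a b c n.
Proof.
move=> a0 b0 c0; rewrite -symmetric_seriesE// fact_fps_mul mulr_sumr.
apply: eq_bigr => k _; rewrite fpsC_mul qpower_sum_fps//.
rewrite [k`!%:R * _]mulrCA qbernoulli_sum_fps//.
have a0' := char0 a a0; have c0' := char0 c c0.
rewrite !exprz_subr1// -[in a%:R ^+ n](subnKC (_ : k <= n)%N); last by rewrite -ltnS.
rewrite exprD !natrM !exprMn.
by field; rewrite c0'.
Qed.

End QBernoulliSymmetry.
Theorem theorem4p11 (R : realType) (p : nat) (p_prime : prime p)
    (C : padic_complex R p) (q : C) (q_neq1 : q <> 1)
    (q_near1 : Cp_abs (q - 1) < p%:R `^ (- (p%:R - 1)^-1))
    (w1 w2 w3 : nat) (w1_gt0 : (0 < w1)%N) (w2_gt0 : (0 < w2)%N)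
    (w3_gt0 : (0 < w3)%N) (n : nat) (y1 : Qp C) (y1_Zp : padic_int y1) :
  let y : C := Cp_of_Qp y1 in
  let E1 : C := w1%:R ^ (n%:Z - 1) *
    \sum_(k < n.+1) 'C(n, k)%:R
      * qpower_sum (n - k) (q ^+ (w1 * w2)) (w3 - 1)
      * w2%:R ^+ (n - k) * w3%:R ^ (k%:Z - 1)
      * \sum_(i < w1) q ^+ (w2 * w3 * i)
          * (qbernoulli_poly k (q ^+ (w1 * w3))).[w2%:R * y + w2%:R / w1%:R * i%:R] in
  let E2 : C := w1%:R ^ (n%:Z - 1) *
    \sum_(k < n.+1) 'C(n, k)%:R
      * qpower_sum (n - k) (q ^+ (w1 * w3)) (w2 - 1)
      * w3%:R ^+ (n - k) * w2%:R ^ (k%:Z - 1)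
      * \sum_(i < w1) q ^+ (w2 * w3 * i)
          * (qbernoulli_poly k (q ^+ (w1 * w2))).[w3%:R * y + w3%:R / w1%:R * i%:R] in
  let E3 : C := w2%:R ^ (n%:Z - 1) *
    \sum_(k < n.+1) 'C(n, k)%:R
      * qpower_sum (n - k) (q ^+ (w1 * w2)) (w3 - 1)
      * w1%:R ^+ (n - k) * w3%:R ^ (k%:Z - 1)
      * \sum_(i < w2) q ^+ (w1 * w3 * i)
          * (qbernoulli_poly k (q ^+ (w2 * w3))).[w1%:R * y + w1%:R / w2%:R * i%:R] in
  let E4 : C := w2%:R ^ (n%:Z - 1) *
    \sum_(k < n.+1) 'C(n, k)%:R
      * qpower_sum (n - k) (q ^+ (w2 * w3)) (w1 - 1)
      * w3%:R ^+ (n - k) * w1%:R ^ (k%:Z - 1)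
      * \sum_(i < w2) q ^+ (w1 * w3 * i)
          * (qbernoulli_poly k (q ^+ (w1 * w2))).[w3%:R * y + w3%:R / w2%:R * i%:R] in
  let E5 : C := w3%:R ^ (n%:Z - 1) *
    \sum_(k < n.+1) 'C(n, k)%:R
      * qpower_sum (n - k) (q ^+ (w1 * w3)) (w2 - 1)
      * w1%:R ^+ (n - k) * w2%:R ^ (k%:Z - 1)
      * \sum_(i < w3) q ^+ (w1 * w2 * i)
          * (qbernoulli_poly k (q ^+ (w2 * w3))).[w1%:R * y + w1%:R / w3%:R * i%:R] in
  let E6 : C := w3%:R ^ (n%:Z - 1) *
    \sum_(k < n.+1) 'C(n, k)%:R
      * qpower_sum (n - k) (q ^+ (w2 * w3)) (w1 - 1)
      * w2%:R ^+ (n - k) * w1%:R ^ (k%:Z - 1)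
      * \sum_(i < w3) q ^+ (w1 * w2 * i)
          * (qbernoulli_poly k (q ^+ (w1 * w3))).[w2%:R * y + w2%:R / w3%:R * i%:R] in
  [/\ E1 = E2, E2 = E3, E3 = E4, E4 = E5 & E5 = E6].
Proof.
move=> y /=.
have q1 : q != 1 by apply/eqP.
have E := qbernoulli_symmetric_series p_prime q q1 q_near1 n y.
have E1 := E w1 w2 w3 w1_gt0 w2_gt0 w3_gt0.
have E2 := E w1 w3 w2 w1_gt0 w3_gt0 w2_gt0.
have E3 := E w2 w1 w3 w2_gt0 w1_gt0 w3_gt0.
have E4 := E w2 w3 w1 w2_gt0 w3_gt0 w1_gt0.
have E5 := E w3 w1 w2 w3_gt0 w1_gt0 w2_gt0.
have E6 := E w3 w2 w1 w3_gt0 w2_gt0 w1_gt0.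
(* The permuted instances are brought to the order of factors used in the statement. *)
rewrite [(w3 * w2)%N]mulnC in E2 E5 E6; rewrite [(w2 * w1)%N]mulnC in E3 E4 E6.
rewrite [(w3 * w1)%N]mulnC in E4 E5 E6.
rewrite E1 E2 E3 E4 E5 E6.
have sl := symmetric_series_swapl q y; have sr := symmetric_series_swapr q y.
split; [by rewrite sr | by rewrite sr sl | by rewrite sr | | by rewrite sr].
by rewrite sl sr.
Qed.
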